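(* A Petri net system $(\mathcal{N},M,M')$ admits a cut-off if and only if there is a continuous firing sequence $\sigma$ with $M\xrightarrow{\sigma}_{\mathbb{Q}}M'$ and the marking equation $M'=M+\mathcal{A}\mathbf{v}$ has a solution $\mathbf{y}\in\mathbb{Z}^T$ with $\mathrm{supp}(\mathbf{y})\subseteq\mathrm{supp}(\sigma)$.
   Context: A Petri net is $\mathcal{N}=(P,T,\mathrm{Pre},\mathrm{Post})$ with finite sets $P,T$ and $\mathrm{Pre},\mathrm{Post}\in\mathbb{N}^{P\times T}$; $\mathcal{A}=\mathrm{Post}-\mathrm{Pre}$ is its incidence matrix. Markings are in $\mathbb{N}^P$; $M\xrightarrow{t}M'$ if $M(p)\ge\mathrm{Pre}[p,t]$ for all $p$ and $M'=M+\mathcal{A}[\cdot,t]$; $\xrightarrow{*}$ is reachability by finitely many firings. A Petri net system is $(\mathcal{N},M,M')$ with markings $M\neq M'$; it admits a cut-off if there is $B\in\mathbb{N}$ with $n\cdot M\xrightarrow{*}n\cdot M'$ for all $n\ge B$. Continuous semantics: for $M\in\mathbb{Q}_{\ge0}^P$ and $\lambda\in\mathbb{Q}_{\ge0}$, $M\xrightarrow{\lambda t}_{\mathbb{Q}}M+\lambda\mathcal{A}[\cdot,t]$ provided $M(p)\ge\lambda\mathrm{Pre}[p,t]$ for all $p$; a continuous firing sequence $\sigma=\lambda_1t_1\cdots\lambda_kt_k$ is fired successively. $\mathrm{supp}(\sigma)$ is the set of $t$ with $\sum_{i:t_i=t}\lambda_i\neq0$; $\mathrm{supp}(\mathbf{y})=\{t:\mathbf{y}(t)\neq0\}$.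 *)

(* Defs.v *)
From HB Require Import structures.
From mathcomp Require Import all_boot all_order all_algebra.

Set Implicit Arguments.
Unset Strict Implicit.
Unset Printing Implicit Defensive.

Import Order.TTheory GRing.Theory Num.Theory.
Local Open Scope ring_scope.

Record petri_net (P T : finType) := PetriNet {
  Pre : P -> T -> nat;
  Post : P -> T -> nat
}.

Definition marking (P : finType) := {ffun P -> nat}.

Definition incidence (P T : finType) (N : petri_net P T) (p : P) (t : T) : int :=
  (Post N p t)%:Z - (Pre N p t)%:Z.

Definition fires (P T : finType) (N : petri_net P T)
    (M : marking P) (t : T) (M' : marking P) : Prop :=
  (forall p, (Pre N p t <= M p)%N) /\
  (forall p, (M' p)%:Z = (M p)%:Z + incidence N p t).

Fixpoint fires_seq (P T : finType) (N : petri_net P T)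
    (M : marking P) (s : seq T) (M' : marking P) : Prop :=
  if s is t :: s' then exists M1, fires N M t M1 /\ fires_seq N M1 s' M'
  else M = M'.

Definition reachable (P T : finType) (N : petri_net P T) (M M' : marking P) : Prop :=
  exists s : seq T, fires_seq N M s M'.

Definition scale_marking (P : finType) (n : nat) (M : marking P) : marking P :=
  [ffun p => (n * M p)%N].

Definition admits_cutoff (P T : finType) (N : petri_net P T) (M M' : marking P) : Prop :=
  exists B : nat, forall n : nat, (B <= n)%N ->
    reachable N (scale_marking n M) (scale_marking n M').

(* Rational vectors; nonnegativity is imposed in [cfires]. *)
Definition cmarking (P : finType) := {ffun P -> rat}.

Definition cmarking_of (P : finType) (M : marking P) : cmarking P :=
  [ffun p => (M p)%:R].

(* Nonnegativity of M' follows from the other conditions. *)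
Definition cfires (P T : finType) (N : petri_net P T)
    (M : cmarking P) (lam : rat) (t : T) (M' : cmarking P) : Prop :=
  [/\ forall p, 0 <= M p,
      0 <= lam,
      forall p, lam * (Pre N p t)%:R <= M p
    & forall p, M' p = M p + lam * (incidence N p t)%:~R].

Fixpoint cfires_seq (P T : finType) (N : petri_net P T)
    (M : cmarking P) (sigma : seq (rat * T)) (M' : cmarking P) : Prop :=
  if sigma is (lam, t) :: sigma' then
    exists M1, cfires N M lam t M1 /\ cfires_seq N M1 sigma' M'
  else M = M'.

Definition supp_seq (T : finType) (sigma : seq (rat * T)) : {set T} :=
  [set t | \sum_(x <- sigma | x.2 == t) x.1 != 0].

Definition supp (T : finType) (y : {ffun T -> int}) : {set T} :=
  [set t | y t != 0].

Definition marking_equation (P T : finType) (N : petri_net P T)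
    (M M' : marking P) (v : {ffun T -> int}) : Prop :=
  forall p, (M' p)%:Z = (M p)%:Z + \sum_(t : T) incidence N p t * v t.

(* Main.v *)
(** If [s1] and [s2] realise [B] and [B + 1] copies, the difference of their
    Parikh images is an integral solution, and [s1 ++ s2], scaled by
    [1 / (2B + 1)], is a continuous run whose support contains it.

    Conversely, clearing denominators in [sigma] gives a discrete run [s] from
    [d M] to [d M'] whose Parikh image [x] has the support of [sigma].  Take two
    groups of [c] staggerings of copies of this run, so that together they can
    afford the multiset [2 c x] at once.  Firing [c x + r y] there, which lies
    between [0] and [2 c x] for large [c], advances one group by a step in each
    copy and moves [r M] to [r M']; every copy can then be completed.  This
    reaches every residue [r] modulo [d]. *)
Require Import Defs.
From mathcomp Require Import all_boot all_order all_algebra.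
From mathcomp Require Import zify.

Set Implicit Arguments.
Unset Strict Implicit.
Unset Printing Implicit Defensive.

Import Order.TTheory GRing.Theory Num.Theory.
Local Open Scope ring_scope.

Lemma mulrn_natz (a : int) n : a *+ n = a * n%:Z.
Proof. by rewrite -mulr_natr natz. Qed.

(** * Discrete runs, their Parikh images, and staggered copies of a run *)

Section Discrete.

Variables (P T : finType) (N : petri_net P T).
Implicit Types (X Y Z W : marking P) (s : seq T) (t : T) (p : P).

Lemma addmE X Y p : (X + Y) p = (X p + Y p)%N.
Proof. by rewrite ffunE. Qed.

Lemma fires_seq_cat X Y Z s1 s2 :
  fires_seq N X s1 Y -> fires_seq N Y s2 Z -> fires_seq N X (s1 ++ s2) Z.
Proof.
elim: s1 X => [|t s1 IH] X /=; first by move=> ->.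
by move=> [X1 [tX sX1]] sY; exists X1; split=> //; apply: IH.
Qed.

Lemma fires_seq_frame X Y Z s :
  fires_seq N X s Y -> fires_seq N (X + Z) s (Y + Z).
Proof.
elim: s X => [|t s IH] X /=; first by move=> ->.
move=> [X1 [[enX eqX] sX1]]; exists (X1 + Z); split; last exact: IH.
split=> p; have := enX p; have := eqX p; rewrite !addmE; lia.
Qed.

Lemma fires_seq_effect X Y s p :
  fires_seq N X s Y ->
  (Y p)%:Z = (X p)%:Z + \sum_(t <- s) incidence N p t.
Proof.
elim: s X => [|t s IH] X /=; first by move=> ->; rewrite big_nil addr0.
by move=> [X1 [[_ eqX] sX1]]; rewrite (IH _ sX1) eqX big_cons -addrA.
Qed.

Lemma reachable_refl X : reachable N X X.
Proof. by exists [::]. Qed.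

Lemma reachable_trans Y X Z :
  reachable N X Y -> reachable N Y Z -> reachable N X Z.
Proof.
move=> [s1 H1] [s2 H2]; exists (s1 ++ s2); exact: fires_seq_cat H1 H2.
Qed.

Lemma reachable_add X Y X' Y' :
  reachable N X Y -> reachable N X' Y' -> reachable N (X + X') (Y + Y').
Proof.
move=> [s1 H1] [s2 H2]; exists (s1 ++ s2).
apply: (fires_seq_cat (fires_seq_frame X' H1)).
by rewrite ![Y + _]addrC; apply: fires_seq_frame.
Qed.

Lemma scale_marking0 X : scale_marking 0 X = 0.
Proof. by apply/ffunP=> p; rewrite !ffunE. Qed.

Lemma scale_marking1 X : scale_marking 1 X = X.
Proof. by apply/ffunP=> p; rewrite !ffunE mul1n. Qed.

Lemma scale_markingDl m n X :
  scale_marking (m + n) X = scale_marking m X + scale_marking n X.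
Proof. by apply/ffunP=> p; rewrite addmE !ffunE mulnDl. Qed.

Lemma scale_markingA m n X :
  scale_marking m (scale_marking n X) = scale_marking (m * n) X.
Proof. by apply/ffunP=> p; rewrite !ffunE mulnA. Qed.

Lemma reachable_scale n X Y :
  reachable N X Y -> reachable N (scale_marking n X) (scale_marking n Y).
Proof.
move=> XY; elim: n => [|n IH].
  by rewrite !scale_marking0; apply: reachable_refl.
by rewrite -addn1 !scale_markingDl !scale_marking1; apply: reachable_add.
Qed.

(** If [X] pays for all the firings in advance, no transition has to wait for tokens produced by
    another: after the head of [s] fires, the rest is still paid for. Hence the order is irrelevant
    and the total effect alone determines [Y]. *)
Lemma fires_seq_enabled s X Y :
  (forall p, (\sum_(t <- s) Pre N p t <= X p)%N) ->
  (forall p, (Y p)%:Z = (X p)%:Z + \sum_(t <- s) incidence N p t) ->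
  fires_seq N X s Y.
Proof.
elim: s X => [|t s IH] X enX eqX /=.
  by apply/ffunP=> p; have := eqX p; rewrite big_nil addr0 => -[].
pose X1 : marking P := [ffun p => (X p - Pre N p t + Post N p t)%N].
have eqX1 p : (X1 p)%:Z = (X p)%:Z + incidence N p t.
  by have := enX p; rewrite big_cons ffunE /incidence; lia.
exists X1; split; last first.
  apply: IH => p; last by rewrite eqX1 eqX big_cons -[RHS]addrA.
  by have := enX p; rewrite big_cons ffunE; lia.
split=> // p.
by have := enX p; rewrite big_cons; lia.
Qed.

(** Passes from a run to its Parikh image. It is used in [nat] for tokens consumed and in [int] for
    effects. *)
Lemma sum_count (A : nmodType) (F : T -> A) s :
  \sum_(t <- s) F t = \sum_t F t *+ count_mem t s.
Proof.
elim: s => [|t s IH]; first by rewrite big_nil big1.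
rewrite big_cons IH (eq_bigr _ (fun u _ => mulrnDr (F u) _ _)) big_split /=.
congr (_ + _); rewrite (bigD1 t) //= eqxx big1 ?addr0 // => u /negPf.
by rewrite eq_sym => ->.
Qed.

Lemma reachable_parikh (z : T -> nat) X Y :
  (forall p, (\sum_t Pre N p t * z t <= X p)%N) ->
  (forall p, (Y p)%:Z = (X p)%:Z + \sum_t incidence N p t * (z t)%:Z) ->
  reachable N X Y.
Proof.
(* Any ordering of the multiset [z] will do, so equal transitions are grouped. *)
pose s := flatten [seq nseq (z t) t | t <- enum T].
have sumE (A : nmodType) (F : T -> A) : \sum_(t <- s) F t = \sum_t F t *+ z t.
  rewrite big_flatten big_map big_enum; apply: eq_bigr => t _.
  by rewrite big_nseq Algebra.iter_addr addr0.
move=> enX eqX; exists s; apply: fires_seq_enabled => p.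
  apply: leq_trans (enX p); rewrite leq_eqVlt; apply/orP; left; apply/eqP.
  rewrite [LHS]sumE; apply: eq_bigr => t _.
  by rewrite -[LHS]mulr_natr natn.
rewrite eqX sumE; congr (_ + _); apply: eq_bigr => t _.
by rewrite mulrn_natz.
Qed.

(* Stagger [size s] copies of the run: [W] is the sum of the markings met just
   before, and [W'] just after, each step of the run. *)
Lemma fires_seq_stagger X Y s :
  fires_seq N X s Y ->
  exists W W', [/\ reachable N (scale_marking (size s) X) W,
    reachable N W (scale_marking (size s) Y),
    reachable N W' (scale_marking (size s) Y),
    forall p, (\sum_(t <- s) Pre N p t <= W p)%N &
    forall p, (W' p)%:Z = (W p)%:Z + \sum_(t <- s) incidence N p t].
Proof.
elim: s X => [|t s IH] X.
  move=> _; exists 0, 0; rewrite /= !scale_marking0.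
  by split=> [||| p|p]; rewrite ?big_nil ?ffunE //; apply: reachable_refl.
move=> XY; have [X1 [tX sX1]] := XY.
have [W [W' [X1W WY W'Y enW eqW]]] := IH _ sX1.
have XX1 : reachable N X X1 by exists [:: t], X1.
have X1Y : reachable N X1 Y by exists s.
(* The new copy waits at [X], about to fire [t]; the [size s] others fire [t] first and are
   staggered along [s] from [X1]. *)
exists (X + W), (X1 + W').
rewrite [size _]/= -add1n !scale_markingDl !scale_marking1.
split=> [||| p|p]; try apply: reachable_add => //.
- exact: reachable_refl.
- exact: reachable_trans (reachable_scale _ XX1) X1W.
- by exists (t :: s).
- by case: tX => enX _; rewrite big_cons addmE; apply: leq_add.
- case: tX => _ eqX; move: (eqX p) (eqW p).
  by rewrite big_cons !addmE !PoszD => -> ->; rewrite addrACA.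
Qed.

End Discrete.

(** * Translation between discrete and continuous runs *)

Section Continuous.

Variables (P T : finType) (N : petri_net P T).
Implicit Types (X Y M : marking P) (s : seq T) (t : T) (p : P).
Implicit Types (C : cmarking P) (sigma : seq (rat * T)).

Lemma cfires_seq_of_fires_seq (c : rat) X Y s :
  0 <= c -> fires_seq N X s Y ->
  cfires_seq N [ffun p => c * (X p)%:R] [seq (c, t) | t <- s]
    [ffun p => c * (Y p)%:R].
Proof.
move=> c_ge0; elim: s X => [|t s IH] X /=; first by move=> ->.
move=> [X1 [[enX eqX] sX1]]; exists [ffun p => c * (X1 p)%:R].
split; last exact: IH.
split=> // p; rewrite !ffunE.
- by rewrite mulr_ge0 ?ler0n.
- by rewrite ler_wpM2l // ler_nat.
- by rewrite -mulrDr -[(X p)%:R]/((X p)%:Z%:~R) -intrD -eqX.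
Qed.

Lemma mem_supp_seq_map (c : rat) s t :
  c != 0 -> (t \in supp_seq [seq (c, u) | u <- s]) = (t \in s).
Proof.
move=> c_neq0; rewrite inE big_map big_const_seq /= Algebra.iter_addr addr0.
by rewrite mulrn_eq0 (negPf c_neq0) orbF -lt0n -has_count has_pred1.
Qed.

Lemma cfires_seq_ge0 C sigma C' :
  cfires_seq N C sigma C' -> forall x, x \in sigma -> 0 <= x.1.
Proof.
elim: sigma C => [|[lam t] sigma IH] C //= [C1 [[_ lam_ge0 _ _] sC1]] x.
by rewrite inE => /predU1P[-> //|]; apply: IH sC1 x.
Qed.

(** The product of the denominators works; nonnegativity makes the resulting integers natural
    numbers. *)
Lemma common_denominator sigma :
  (forall x, x \in sigma -> 0 <= x.1) ->
  exists2 d : nat, (0 < d)%N &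
    forall x, x \in sigma -> exists a : nat, d%:R * x.1 = a%:R.
Proof.
elim: sigma => [|[q t] sigma IH] ge0; first by exists 1%N.
have [|d d_gt0 dP] := IH.
  by move=> x xs; apply: ge0; rewrite inE xs orbT.
have q_ge0 : 0 <= q by apply: (ge0 (q, t)); rewrite inE eqxx.
have qE : `|denq q|%:R * q = `|numq q|%:R.
  rewrite -[q in _ * q]divq_num_den !natr_absz !ger0_norm ?numq_ge0 //.
  by rewrite mulrC divfK // intr_eq0 denq_eq0.
exists (d * `|denq q|)%N; first by rewrite muln_gt0 d_gt0 absz_gt0 denq_eq0.
move=> x; rewrite inE => /predU1P[->|/dP[a aE]].
  by exists (d * `|numq q|)%N; rewrite !natrM /= -mulrA qE.
by exists (`|denq q| * a)%N; rewrite !natrM mulrAC aE mulrC.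
Qed.

(** After scaling by [d], the step [lam t] becomes [a = d * lam] consecutive firings of [t]. The
    continuous guard, scaled likewise, pays for all [a] of them at once. *)
Lemma fires_seq_of_cfires_seq (d : nat) C sigma C' X :
  (forall x, x \in sigma -> exists a : nat, d%:R * x.1 = a%:R) ->
  (forall p, (X p)%:R = d%:R * C p) ->
  cfires_seq N C sigma C' ->
  exists s Y, [/\ fires_seq N X s Y,
    forall p, (Y p)%:R = d%:R * C' p &
    forall t, (count_mem t s)%:R = d%:R * \sum_(x <- sigma | x.2 == t) x.1].
Proof.
elim: sigma C X => [|[lam t] sigma IH] C X dP XE /=.
  move=> <-; exists [::], X; split=> // t; by rewrite big_nil mulr0.
move=> [C1 [[_ _ enC eqC] sC1]].
have [a /= aE] := dP _ (mem_head _ _).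
have enX p : (Pre N p t * a <= X p)%N.
  rewrite -(ler_nat rat) natrM XE -aE mulrC -mulrA.
  by rewrite ler_wpM2l ?ler0n.
(* By [enX] the truncated subtraction is exact. *)
pose X1 : marking P := [ffun p => (X p - Pre N p t * a + Post N p t * a)%N].
have eqX1 p : (X1 p)%:Z = (X p)%:Z + incidence N p t * a%:Z.
  by have := enX p; rewrite ffunE /incidence; lia.
have X1E p : (X1 p)%:R = d%:R * C1 p.
  rewrite -[(X1 p)%:R]/((X1 p)%:Z%:~R) eqX1 intrD intrM eqC mulrDr -XE.
  by rewrite mulrA aE [_%:~R * _]mulrC.
have sumt : fires_seq N X (nseq a t) X1.
  apply: fires_seq_enabled => p.
    by rewrite big_nseq iter_addn addn0.
  by rewrite eqX1 big_nseq Algebra.iter_addr addr0 mulrn_natz.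
have [|s [Y [sX1 YE cE]]] := IH C1 X1 _ X1E sC1.
  by move=> x xs; apply: dP; rewrite inE xs orbT.
exists (nseq a t ++ s), Y; split=> // [|u]; first exact: fires_seq_cat sumt sX1.
rewrite count_cat count_nseq natrD cE big_cons /=; case: eqP => _.
  by rewrite mul1n mulrDr aE.
by rewrite mul0n add0r.
Qed.

Lemma scale_cmarking (d : nat) M :
  (0 < d)%N ->
  [ffun p => d%:R^-1 * (scale_marking d M p)%:R] = cmarking_of M.
Proof.
move=> d_gt0; apply/ffunP=> p; rewrite !ffunE natrM mulKf //.
by rewrite pnatr_eq0 -lt0n.
Qed.

End Continuous.

(** * The two directions of the equivalence *)

Section Cutoff.

Variables (P T : finType) (N : petri_net P T) (M M' : marking P).

Lemma cutoff_continuous :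
  admits_cutoff N M M' ->
  exists sigma : seq (rat * T),
    cfires_seq N (cmarking_of M) sigma (cmarking_of M') /\
    exists y : {ffun T -> int},
      marking_equation N M M' y /\ supp y \subset supp_seq sigma.
Proof.
move=> [B HB]; have [s1 Hs1] := HB _ (leqnn B).
have [s2 Hs2] := HB _ (leqnSn B).
have Hs : fires_seq N (scale_marking (B + B.+1) M) (s1 ++ s2)
            (scale_marking (B + B.+1) M').
  rewrite !scale_markingDl; apply: fires_seq_cat (fires_seq_frame _ Hs1) _.
  by rewrite ![scale_marking B M' + _]addrC; apply: fires_seq_frame.
(* Positive even when [B] is 0, so dividing by it is legitimate. *)
have d_gt0 : (0 < B + B.+1)%N by rewrite addnS.
have dV_gt0 : 0 < (B + B.+1)%:R^-1 :> rat by rewrite invr_gt0 ltr0n.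
exists [seq ((B + B.+1)%:R^-1, t) | t <- s1 ++ s2]; split.
  have := cfires_seq_of_fires_seq (ltW dV_gt0) Hs.
  by rewrite !scale_cmarking.
exists [ffun t => (count_mem t s2)%:Z - (count_mem t s1)%:Z]; split.
  move=> p; have := fires_seq_effect p Hs1; have := fires_seq_effect p Hs2.
  rewrite (sum_count _ s1) (sum_count _ s2) !ffunE => e2 e1.
  have -> : \sum_t incidence N p t *
        [ffun t => (count_mem t s2)%:Z - (count_mem t s1)%:Z] t =
      \sum_t incidence N p t *+ count_mem t s2 -
      \sum_t incidence N p t *+ count_mem t s1.
    rewrite -sumrB; apply: eq_bigr => t _.
    by rewrite ffunE mulrBr !mulrn_natz.
  by move: (\sum_t _) (\sum_t _) e1 e2 => S1 S2; nia.
apply/subsetP=> t; rewrite mem_supp_seq_map ?gt_eqF // inE ffunE mem_cat.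
(* A transition absent from both runs has both counts zero, so [y] vanishes there. *)
apply: contraR; rewrite negb_or => /andP[t1 t2].
by rewrite !(count_memPn _) ?subrr.
Qed.

Lemma continuous_cutoff sigma (y : {ffun T -> int}) :
  cfires_seq N (cmarking_of M) sigma (cmarking_of M') ->
  marking_equation N M M' y -> supp y \subset supp_seq sigma ->
  admits_cutoff N M M'.
Proof.
move=> sMM' yE y_sigma.
have [d d_gt0 dP] := common_denominator (cfires_seq_ge0 sMM').
have [|s [Y [sMY YE cE]]] :=
  @fires_seq_of_cfires_seq _ _ N d _ sigma _ (scale_marking d M) dP _ sMM'.
  by move=> p; rewrite !ffunE natrM.
have {}YE : Y = scale_marking d M'.
  apply/ffunP=> p; apply/eqP; rewrite -(eqr_nat rat) YE.
  by rewrite !ffunE natrM.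
rewrite {}YE in sMY.
(* The count of [t] in [s] is [d] times its total amount in [sigma], so the inclusion of supports
   carries over to [s]. *)
have y_s t : y t != 0 -> (0 < count_mem t s)%N.
  move=> yt; have /(subsetP y_sigma) : t \in supp y by rewrite inE.
  rewrite inE lt0n -(eqr_nat rat) cE mulf_eq0 negb_or => ->.
  by rewrite pnatr_eq0 -lt0n d_gt0.
have [W [W' [MW WM' W'M' enW eqW]]] := fires_seq_stagger sMY.
rewrite !scale_markingA in MW WM' W'M'.
set x := fun t => count_mem t s; set L := size s in MW WM' W'M'.
(* [c * x] dominates [r * y] in absolute value for every [r < d]. *)
pose c := (d * \sum_t `|y t|)%N.
(* Each of the two groups holds [c] staggerings of [L] runs from [d M]. The remaining copies number
   [k * d + r]: [k] plain repetitions of the run handle [k * d], and only [r] need [y]. *)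
exists (2 * c * (L * d))%N => n n_ge.
pose k := ((n - 2 * c * (L * d)) %/ d)%N.
pose r := ((n - 2 * c * (L * d)) %% d)%N.
have r_lt : (r < d)%N by rewrite ltn_mod.
have -> : n = (c * (L * d) + c * (L * d) + (k * d + r))%N.
  by rewrite -divn_eq addnn -mul2n mulnA subnKC.
have ry_le t : (`|(r%:Z * y t)%R| <= c * x t)%N.
  have [->|/y_s xt] := eqVneq (y t) 0; first by rewrite mulr0.
  have yt : (`|y t| <= \sum_u `|y u|)%N by rewrite (bigD1 t) //= leq_addr.
  rewrite abszM absz_nat /c -[leqLHS]muln1 leq_mul // leq_mul //.
  exact: ltnW.
(* The absolute value only converts to [nat]: by [ry_le] the integer is nonnegative. *)
pose z t := `|((c * x t)%N%:Z + r%:Z * y t)%R|%N.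
have zE t : (z t)%:Z = (c * x t)%N%:Z + r%:Z * y t.
  by have := ry_le t; rewrite /z; lia.
have z_le t : (z t <= 2 * (c * x t))%N.
  by have := ry_le t; have := zE t; lia.
have kMM' : reachable N (scale_marking (k * d) M) (scale_marking (k * d) M').
  by rewrite -!scale_markingA; apply: reachable_scale; exists s.
rewrite !(scale_markingDl, addrA).
pose cW := scale_marking c W; pose cW' := scale_marking c W'.
have mid : reachable N (cW + cW + scale_marking r M)
                       (cW + cW' + scale_marking r M').
  apply: (reachable_parikh (z := z)) => p.
    rewrite !addmE !ffunE.
    have le1 : (\sum_t Pre N p t * z t <= 2 * c * \sum_(t <- s) Pre N p t)%N.
      have -> : (\sum_(t <- s) Pre N p t = \sum_t Pre N p t * x t)%N.
        rewrite [LHS](sum_count (Pre N p) s); apply: eq_bigr => t _.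
        by rewrite -[LHS]mulr_natr natn.
      rewrite big_distrr; apply: leq_sum => t _.
      by rewrite /= [leqRHS]mulnCA leq_mul2l -mulnA z_le orbT.
    apply: leq_trans le1 _.
    apply: leq_trans (leq_mul (leqnn _) (enW p)) _.
    by rewrite -mulnA mul2n -addnn leq_addr.
  rewrite !addmE !ffunE.
  (* The effect splits: [c x] turns one [cW] into [cW'], and [r y] turns [r M] into [r M']. *)
  under eq_bigr => t _ do rewrite zE PoszM mulrDr !(mulrCA (incidence _ _ _)).
  rewrite big_split -!mulr_sumr /=.
  have -> : \sum_t incidence N p t * (x t)%:Z = (W' p)%:Z - (W p)%:Z.
    rewrite eqW addrAC subrr add0r (sum_count _ s).
    by apply: eq_bigr => t _; rewrite mulrn_natz.
  have -> : \sum_t incidence N p t * y t = (M' p)%:Z - (M p)%:Z.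
    by rewrite yE addrAC subrr add0r.
  by nia.
(* Staggered copies can finish both from [W], for the group left in place, and from [W'], for the
   group advanced. *)
have fin : reachable N (cW + cW' + scale_marking r M')
   (scale_marking (c * (L * d)) M' + scale_marking (c * (L * d)) M'
     + scale_marking r M').
  apply: reachable_add (reachable_refl _ _).
  by rewrite -!(scale_markingA c); apply: reachable_add; apply: reachable_scale.
have ini : reachable N (scale_marking (c * (L * d)) M
     + scale_marking (c * (L * d)) M + scale_marking r M)
   (cW + cW + scale_marking r M).
  apply: reachable_add (reachable_refl _ _).
  by rewrite -!(scale_markingA c); apply: reachable_add; apply: reachable_scale.
rewrite ![_ + scale_marking (k * d) _ + _]addrAC.
exact: reachable_add (reachable_trans ini (reachable_trans mid fin)) kMM'.
Qed.

End Cutoff.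

Theorem theorem5p1 (P T : finType) (N : petri_net P T) (M M' : marking P)
    (hMM' : M <> M') :
  admits_cutoff N M M' <->
  exists sigma : seq (rat * T),
    cfires_seq N (cmarking_of M) sigma (cmarking_of M') /\
    exists y : {ffun T -> int},
      marking_equation N M M' y /\ supp y \subset supp_seq sigma.
Proof.
split; first exact: cutoff_continuous.
by move=> [sigma [sMM' [y [yE ysub]]]]; apply: continuous_cutoff sMM' yE ysub.
Qed.
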